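(* Let $G\in\mathcal G$ be the demand distribution and $\lambda\ge 0$ the observable boundary. 1. If $G^-(\lambda)\ge\rho$, then the minimax optimal ordering quantity (a quantity at which the infimum defining the minimax risk is attained) and the minimax risk are $$q^{\Delta}=q^\star_G<\lambda,\qquad \Delta=0.$$ 2. If $G^-(\lambda)<\rho$, then $$q^{\Delta}=\frac{bM+h\lambda-(b+h)G^-(\lambda)M}{(b+h)(1-G^-(\lambda))},\qquad \Delta=\frac{h\left(b-(b+h)G^-(\lambda)\right)(M-\lambda)}{(b+h)(1-G^-(\lambda))}\ge 0.$$
   Context: Fix costs $b,h>0$, let $\rho=\frac{b}{b+h}\in(0,1)$, and let $M\ge 0$ be a finite constant. For a cdf $F$ of a nonnegative random variable $D$ (demand) with $\mathbb E_F[D]<\infty$ and $q\ge 0$, the newsvendor cost is $C_F(q)=\mathbb E_F[b(D-q)^+ + h(q-D)^+]$, and $q^\star_F=\inf\{q : F(q)\ge\rho\}$. Let $\mathcal G=\{F : F \text{ has nonnegative support},\ \mathbb E_F[D]<\infty,\ q^\star_F\le M\}$. For $G\in\mathcal G$ and $\lambda\ge 0$: $G^-(\lambda)=\mathbb P_G(D<\lambda)$; the ambiguity set is $\mathcal F(\lambda;G)=\{F\in\mathcal G : F(x)=G(x)\ \forall x<\lambda\}$; the (worst-case) regret of $q$ is $\mathrm{Regret}(q)=\sup_{F\in\mathcal F(\lambda;G)}\{C_F(q)-C_F(q^\star_F)\}$; the minimax risk is $\Delta=\inf_{q\in[0,M]}\mathrm{Regret}(q)$; a quantity $q^{\Delta}\in[0,M]$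 attaining this infimum, if it exists, is called the minimax optimal ordering quantity.
   Formalization: In part 1 the strict inequality q*_G < λ fails when G^-(λ) = ρ and G(x) < ρ for all x < λ (e.g. G uniform on [0,1], λ = ρ); there q*_G = λ is proved instead, while optimality of q*_G and Δ = 0 still hold. *)

(* Defs.v *)
From HB Require Import structures.
From mathcomp Require Import all_boot all_order all_algebra.
From mathcomp Require Import all_classical all_reals all_analysis.

Set Implicit Arguments.
Unset Strict Implicit.
Unset Printing Implicit Defensive.

Import Order.TTheory GRing.Theory Num.Theory.
Import numFieldNormedType.Exports.

Local Open Scope classical_set_scope.
Local Open Scope ring_scope.

(* A nondecreasing right-continuous function R -> R with limits 0 at -oo and
   1 at +oo. *)
Notation cdfType R := (cumulativeBounded (0 : R) (1 : R)).

(* The law on R of a random variable D with cdf F. All expectations and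
   probabilities below are taken with respect to it, D being the identity. *)
Definition law (R : realType) (F : cdfType R) :
    probability (measurableTypeR R) R :=
  lebesgue_stieltjes_measure F.

Definition nonneg_support (R : realType) (F : cdfType R) : Prop :=
  law F `]-oo, 0[%classic = 0%E.

(* For F with nonnegative support the negative part of D is a.s. zero, so this
   says that D is integrable. *)
Definition finite_mean (R : realType) (F : cdfType R) : Prop :=
  ('E_(law F)[fun D : R => D] < +oo)%E.

Definition critical_ratio (R : realType) (b h : R) : R := b / (b + h).

(* C_F(q), extended-real valued; finite when D has a finite mean. *)
Definition newsvendor_cost (R : realType) (b h : R) (F : cdfType R) (q : R) :
    \bar R :=
  'E_(law F)[(fun D : R => b * Num.max (D - q) 0 + h * Num.max (q - D) 0)%R]%E.

(* The infimum is over a set that is nonempty and bounded below, because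
   0 < rho < 1 and F has limits 0 and 1. *)
Definition qstar (R : realType) (b h : R) (F : cdfType R) : R :=
  inf [set q : R | critical_ratio b h <= F q].

Definition admissible (R : realType) (b h M : R) : set (cdfType R) :=
  [set F | [/\ nonneg_support F, finite_mean F & qstar b h F <= M]].

(* G^-(lambda) = P_G(D < lambda). *)
Definition cdf_left (R : realType) (G : cdfType R) (lambda : R) : R :=
  fine (law G `]-oo, lambda[%classic).

Definition ambiguity_set (R : realType) (b h M lambda : R) (G : cdfType R) :
    set (cdfType R) :=
  [set F | admissible b h M F /\ forall x : R, x < lambda -> F x = G x].

(* Taking suprema and infima in the extended reals avoids any default value
   for unbounded sets. *)
Definition regret (R : realType) (b h M lambda : R) (G : cdfType R) (q : R) :
    \bar R :=
  ereal_sup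
    [set (newsvendor_cost b h F q - newsvendor_cost b h F (qstar b h F))%E
      | F in ambiguity_set b h M lambda G].

Definition minimax_risk (R : realType) (b h M lambda : R) (G : cdfType R) :
    \bar R :=
  ereal_inf [set regret b h M lambda G q | q in `[0, M]].

Definition minimax_optimal (R : realType) (b h M lambda : R) (G : cdfType R)
    (q : R) : Prop :=
  0 <= q <= M /\ regret b h M lambda G q = minimax_risk b h M lambda G.

(* Main.v *)
(* Only F(x) for x < lambda is known, so the worst cases are the two laws that
   put all the remaining mass 1 - G^-(lambda) at lambda or at M; their critical
   quantiles are lambda and M when G^-(lambda) < rho. Ordering q then costs a
   regret h (q - lambda) in the first case and at least
   (M - q) (b - (b + h) G^-(lambda)) in the second one, and q^Delta is the
   quantity that equalizes the two. Conversely no law does worse: the difference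
   of the losses at q and at the quantile s of F is at most h (q - s) if s <= q;
   if q <= s it is -h (s - q) on D < lambda and at most b (s - q) elsewhere.
   When G^-(lambda) >= rho, the known part of F already determines its
   quantile, so that ordering it has no regret. *)
Require Import Defs.
From HB Require Import structures.
From mathcomp Require Import all_boot all_order all_algebra.
From mathcomp Require Import all_classical all_reals all_analysis.
From mathcomp Require Import measurable_realfun ring lra.

Set Implicit Arguments.
Unset Strict Implicit.
Unset Printing Implicit Defensive.

Import Order.TTheory GRing.Theory Num.Theory.
Import numFieldNormedType.Exports.

Local Open Scope classical_set_scope.
Local Open Scope ring_scope.

(** * Comparison of an expectation with that of a two-valued variable *)

Section two_valued_bounds.
Context d (T : measurableType d) (R : realType) (P : probability T R).
Variables (f : T -> R) (A : set T) (p u v : R).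
Hypotheses (intf : P.-integrable setT (EFin \o f)) (mA : measurable A).
Hypothesis PA : P A = p%:E.

(** The majorant with value [u] on [A] and [v] off [A] is written as [(u - v) * \1_A + v], so that
    linearity gives its integral. *)
Lemma integral_le_two_valued :
  (forall x, A x -> f x <= u) -> (forall x, ~ A x -> f x <= v) ->
  (\int[P]_x (f x)%:E <= (u * p + v * (1 - p))%:E)%E.
Proof.
move=> fu fv.
pose s := (fun x => (u - v)%:E * (\1_A x)%:E)%E.
pose t := (EFin \o cst v : T -> \bar R).
have ints : P.-integrable setT s by apply/integrableZl/integrable_indic.
have intt : P.-integrable setT t by exact: finite_measure_integrable_cst.
have -> : (u * p + v * (1 - p))%:E = (\int[P]_x (s x + t x))%E.
  rewrite integralD// integralZl//; last exact: integrable_indic.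
  have -> : (\int[P]_x (\1_A x)%:E = p%:E)%E by rewrite integral_indic// setIT.
  have -> : (\int[P]_x t x = v%:E)%E.
    rewrite (integral_cst P measurableT v%:E) -[RHS]mule1; congr (_ * _)%E.
    exact: probability_setT.
  by rewrite -EFinM -EFinD; congr EFin; lra.
apply: le_integral => //; first exact: integrableD.
move=> x _; rewrite /s /t /= -EFinM -EFinD lee_fin indicE.
have [/set_mem Ax|] := boolP (x \in A); first by rewrite mulr1 subrK fu.
by rewrite notin_setE => nAx; rewrite mulr0 add0r fv.
Qed.

End two_valued_bounds.

(** The upper bound is applied to [- f], with constants [- u] and [- v]. *)
Lemma integral_ge_two_valued d (T : measurableType d) (R : realType)
    (P : probability T R) (f : T -> R) (A : set T) (p u v : R) :
  P.-integrable setT (EFin \o f) -> measurable A -> P A = p%:E ->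
  (forall x, A x -> u <= f x) -> (forall x, ~ A x -> v <= f x) ->
  ((u * p + v * (1 - p))%:E <= \int[P]_x (f x)%:E)%E.
Proof.
move=> intf mA PA fu fv.
have intNf : P.-integrable setT (EFin \o (fun x => - f x)).
  have -> : EFin \o (fun x => - f x) = (-%E \o (EFin \o f)).
    by apply/funext => x /=; rewrite EFinN.
  exact: integrableN.
have := @integral_le_two_valued _ _ _ P _ A p (- u) (- v) intNf mA PA.
under eq_integral do rewrite EFinN.
rewrite integralN; last exact: integrable_add_def.
rewrite -leeN2 oppeK -EFinN => le_int.
have -> : u * p + v * (1 - p) = - (- u * p + - v * (1 - p)) by lra.
by apply: le_int => x Ax; rewrite lerN2; [exact: fu|exact: fv].
Qed.

(** * Distribution functions, their left limits, and integrability of demand *)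

Section law_facts.
Context (R : realType).
Implicit Types (F G : cdfType R) (x c : R).

Lemma law_itvNyc F x : law F `]-oo, x]%classic = (F x)%:E.
Proof. by have := cdf_lebesgue_stieltjes_id F x; rewrite /= preimage_id. Qed.

Lemma law_itvNyo F c : law F `]-oo, c[%classic = (cdf_left F c)%:E.
Proof. by rewrite /cdf_left fineK// fin_num_measure. Qed.

Lemma le_cdf_left F x c : x < c -> F x <= cdf_left F c.
Proof.
move=> xc; rewrite -lee_fin -law_itvNyc -law_itvNyo le_measure ?inE//.
by apply: subset_itvl; rewrite bnd_simp.
Qed.

Lemma cdf_left_le F c : cdf_left F c <= F c.
Proof.
rewrite -lee_fin -law_itvNyc -law_itvNyo le_measure ?inE//.
by apply: subset_itvl; rewrite bnd_simp.
Qed.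

Lemma cdfType_le1 F x : F x <= 1.
Proof. by rewrite -lee_fin -law_itvNyc probability_le1. Qed.

Lemma cdfType_ge0 F x : 0 <= F x.
Proof. by rewrite -lee_fin -law_itvNyc. Qed.

(** Continuity from below: []-oo, c[] is the increasing union of the intervals []-oo, c - 1/(n+1)]].
    With [le_cdf_left], this makes [cdf_left F c] the supremum of [F] before [c]. *)
Lemma cdf_left_lub F c a : (forall x, x < c -> F x <= a) -> cdf_left F c <= a.
Proof.
move=> Fa; rewrite -lee_fin -law_itvNyo.
pose I n : set (measurableTypeR R) := `]-oo, c - n.+1%:R^-1]%classic.
have -> : `]-oo, c[%classic = \bigcup_n I n.
  apply/seteqP; split => [x|x [n _]]; rewrite /I /= !in_itv/=.
    move=> /ltr_add_invr[k xk]; exists k => //=.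
    by rewrite in_itv/= lerBrDr ltW.
  by move=> /le_lt_trans; apply; rewrite ltrBlDr ltrDl invr_gt0.
have cvgI : law F (I n) @[n --> \oo] --> law F (\bigcup_n I n).
  apply: nondecreasing_cvg_mu => //.
  - by move=> n; exact: measurable_itv.
  - by apply: bigcup_measurable => n _; exact: measurable_itv.
  - move=> m n mn; apply/subsetPset; apply: subset_itvl; rewrite bnd_simp.
    by rewrite lerB// lef_pV2 ?posrE// ler_nat.
rewrite -(cvg_lim _ cvgI)//; apply: lime_le.
  by apply/cvg_ex; exists (law F (\bigcup_n I n)).
near=> n; rewrite law_itvNyc lee_fin Fa// ltrBlDr ltrDl invr_gt0//.
Unshelve. all: by end_near. Qed.

(** As a supremum of values before the boundary, the left limit is common to all members of an
    ambiguity set. *)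
Lemma eq_cdf_left F G c :
  (forall x, x < c -> F x = G x) -> cdf_left F c = cdf_left G c.
Proof.
move=> FG; apply/le_anti/andP; split; apply: cdf_left_lub => x xc.
- by rewrite FG// le_cdf_left.
- by rewrite -FG// le_cdf_left.
Qed.

Lemma nonneg_support_lt0 F x : nonneg_support F -> x < 0 -> F x = 0.
Proof.
rewrite /nonneg_support law_itvNyo => -[F0] x0; apply/le_anti.
by rewrite cdfType_ge0 andbT (le_trans (le_cdf_left F x0))// F0.
Qed.

Lemma nonneg_supportP F : (forall x, x < 0 -> F x = 0) -> nonneg_support F.
Proof.
move=> F0; rewrite /nonneg_support law_itvNyo; congr EFin.
apply/le_anti/andP; split; first by apply: cdf_left_lub => x /F0 ->.
by rewrite -lee_fin -law_itvNyo.
Qed.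

(** [finite_mean] only bounds the integral of the positive part minus that of the negative part.
    Once the null set []-oo, 0[] is dropped from every integral, the negative part vanishes and the
    positive part is the absolute value. *)
Lemma integrable_id F : nonneg_support F -> finite_mean F ->
  (law F).-integrable setT
    ((fun D => (D : R)%:E) : measurableTypeR R -> \bar R).
Proof.
rewrite /nonneg_support /finite_mean unlock => N0 m0.
have mid : measurable_fun setT
    ((fun D => (D : R)%:E) : measurableTypeR R -> \bar R).
  by apply/measurable_EFinP; exact: measurable_id.
apply/integrableP; split => //.
have mN : measurable (`]-oo, 0[%classic : set (measurableTypeR R)).
  exact: measurable_itv.
rewrite integralE in m0.
rewrite
  (@ge0_negligible_integral _ _ _ (law F) setT _ _ mN)//; last first.
  exact: measurableT_comp.
move: m0.
rewrite [X in (_ - X)%E]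
  (@ge0_negligible_integral _ _ _ (law F) setT _ _ mN)//; last first.
  exact: measurable_funeneg.
rewrite [X in (X - _)%E]
  (@ge0_negligible_integral _ _ _ (law F) setT _ _ mN)//; last first.
  exact: measurable_funepos.
have N : forall x : R, (setT `\` `]-oo, 0[%classic) x -> 0 <= x.
  by move=> x [_] /=; rewrite in_itv/= => /negP; rewrite -leNgt.
rewrite [X in (_ - X)%E](_ : _ = 0)%E ?sube0; last first.
  apply: integral0_eq => x /N x0; rewrite funenegE.
  by apply/max_idPr; rewrite -EFinN lee_fin oppr_le0.
congr (_ < _)%E; apply: eq_integral => x /set_mem/N x0.
by rewrite funeposE /= ger0_norm//; apply/max_idPl; rewrite lee_fin.
Qed.

(** The law is carried by [[0, c]]: off the null set [N], demand is dominated by the constant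
    [c]. *)
Lemma finite_mean_bounded F c : nonneg_support F -> F c = 1 -> finite_mean F.
Proof.
move=> F0 Fc; rewrite /finite_mean unlock; apply: integrable_lty => //.
have mid : measurable_fun setT
    ((fun D => (D : R)%:E) : measurableTypeR R -> \bar R).
  by apply/measurable_EFinP; exact: measurable_id.
pose N : set (measurableTypeR R) := (`]-oo, 0[ `|` `]c, +oo[)%classic.
have mN : measurable N by apply: measurableU; exact: measurable_itv.
have N0 : law F N = 0%E.
  apply/null_set_setU; [exact: measurable_itv|exact: measurable_itv|exact: F0|].
  have -> : `]c, +oo[%classic = ~` `]-oo, c]%classic by rewrite setCitvl.
  rewrite (_ : _ (~` _) = (1 - law F `]-oo, c]%classic)%E).
    by rewrite law_itvNyc Fc subee.
  by apply: probability_setC; exact: measurable_itv.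
apply/(negligible_integrable mN) => //.
apply: (@le_integrable _ _ _ _ _ _ _ (EFin \o cst c)).
- by apply: measurableD.
- exact: measurable_funS mid.
- move=> x [_] /not_orP[]/=; rewrite !in_itv/= andbT => /negP + /negP.
  rewrite -!leNgt => x0 xc.
  by rewrite lee_fin !ger0_norm// (le_trans x0).
- by apply: finite_measure_integrable_cst; apply: measurableD.
Qed.

End law_facts.

(** * The critical quantile *)

Section quantile.
Context (R : realType) (b h : R).
Hypotheses (b_gt0 : 0 < b) (h_gt0 : 0 < h).
Variables (F : cdfType R).
Hypothesis F0 : nonneg_support F.
Local Notation rho := (critical_ratio b h).
Local Notation qs := (qstar b h F).

Lemma critical_ratio_gt0 : 0 < critical_ratio b h.
Proof. by rewrite divr_gt0// addr_gt0. Qed.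

Lemma critical_ratio_lt1 : critical_ratio b h < 1.
Proof. by rewrite ltr_pdivrMr ?addr_gt0// mul1r ltrDl. Qed.

Let lboundS : lbound [set q : R | rho <= F q] 0.
Proof.
move=> q /= rhoF; rewrite leNgt; apply/negP => q0; move: rhoF.
by rewrite nonneg_support_lt0// leNgt critical_ratio_gt0.
Qed.

Let nonemptyS : [set q : R | rho <= F q] !=set0.
Proof.
have : \forall x \near +oo, rho <= F x.
  by apply: cvgr_ge (cumulativey F) _ critical_ratio_lt1.
by move=> /pinfty_ex_gt0[x _ Fx]; exists x.
Qed.

Lemma qstar_ge0 : 0 <= qs.
Proof. exact: lb_le_inf. Qed.

Lemma cdf_lt_qstar x : x < qs -> F x < rho.
Proof.
move=> xqs; rewrite ltNge; apply/negP => rhoF.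
by move: xqs; rewrite ltNge ge_inf//; exists 0.
Qed.

Lemma qstar_ge c : (forall x, x < c -> F x < rho) -> c <= qs.
Proof.
move=> Fc; apply: lb_le_inf => // q /= rhoF.
by rewrite leNgt; apply/negP => /Fc; rewrite ltNge rhoF.
Qed.

Lemma qstar_le c : rho <= F c -> qs <= c.
Proof. by move=> rhoF; apply: ge_inf => //; exists 0. Qed.

Lemma qstar_eq c :
  rho <= F c -> (forall x, x < c -> F x < rho) -> qs = c.
Proof.
by move=> rhoF Fc; apply/le_anti; rewrite qstar_le// qstar_ge.
Qed.

(** The infimum is attained by right-continuity: otherwise [F] would stay below the critical ratio
    slightly to the right of [qs], which would push the infimum further right. *)
Lemma cdf_qstar_ge : rho <= F qs.
Proof.
rewrite leNgt; apply/negP => Fqs.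
(* Half of the gap is used because right-continuity yields a non-strict bound. *)
have e0 : 0 < (rho - F qs) / 2 by rewrite divr_gt0// subr_gt0.
have [d Fd] := nondecreasing_right_continuousP qs F e0.
have {}Fd : F (qs + d%:num) < rho by apply: (le_lt_trans Fd) => /=; lra.
have : qs + d%:num <= qs.
  apply: qstar_ge => x xd; apply: le_lt_trans Fd.
  exact/(cumulative_is_nondecreasing F)/ltW.
by rewrite gerDl leNgt gt0.
Qed.

Lemma cdf_left_qstar_le : cdf_left F qs <= rho.
Proof. by apply: cdf_left_lub => x /cdf_lt_qstar/ltW. Qed.

End quantile.

(** * The newsvendor loss and the optimality of the critical quantile *)

Section cost.
Context (R : realType) (b h : R).
Hypotheses (b_gt0 : 0 < b) (h_gt0 : 0 < h).

Definition loss (q x : R) : R :=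
  b * Num.max (x - q) 0 + h * Num.max (q - x) 0.

Variables (F : cdfType R).
Hypothesis F_adm : nonneg_support F /\ finite_mean F.

Let measurable_loss q :
  measurable_fun setT (loss q : measurableTypeR R -> R).
Proof.
apply: measurable_funD; apply: measurable_funM => //;
  apply: measurable_maxr => //; exact: measurable_funB.
Qed.

(** Both positive parts are at most [|x| + |q|], so the loss is dominated by
    [(b + h) * (|x| + |q|)]. *)
Let integrable_loss q :
  (law F).-integrable setT
    (EFin \o (loss q : measurableTypeR R -> R)).
Proof.
have [F0 Fm] := F_adm.
pose g := (fun x => (b + h)%:E * (`|(x : R)%:E| + `|q|%:E))%E :
  measurableTypeR R -> \bar R.
have intg : (law F).-integrable setT g.
  apply: integrableZl => //; apply: integrableD => //.
    by apply: integrable_abse; exact: integrable_id.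
  exact: (@finite_measure_integrable_cst _ _ _ (law F) setT `|q|).
apply: (le_integrable _ _ _ intg) => //; first exact/measurable_EFinP.
move=> x _; rewrite /g /= lee_fin.
have x0 := normr_ge0 x; have q0 := normr_ge0 q.
rewrite [leRHS]ger0_norm; last by rewrite mulr_ge0// addr_ge0// ltW.
have /andP[m1 M1] : 0 <= Num.max (x - q) 0 <= `|x| + `|q|.
  rewrite le_max lexx orbT ge_max (le_trans (ler_norm _) (ler_normB _ _))/=.
  by rewrite addr_ge0.
have /andP[m2 M2] : 0 <= Num.max (q - x) 0 <= `|x| + `|q|.
  rewrite le_max lexx orbT ge_max [`|x| + _]addrC.
  rewrite (le_trans (ler_norm _) (ler_normB _ _))/=.
  by rewrite addr_ge0.
rewrite ger0_norm /loss; last by rewrite addr_ge0// mulr_ge0// ltW.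
by rewrite mulrDl lerD// ler_wpM2l// ltW.
Qed.

Let integrable_loss_gap q q' :
  (law F).-integrable setT
    (EFin \o ((fun x => loss q x - loss q' x) : measurableTypeR R -> R)).
Proof. exact: (integrableB _ (integrable_loss q) (integrable_loss q')). Qed.

Lemma newsvendor_cost_fin_num q : newsvendor_cost b h F q \is a fin_num.
Proof.
rewrite /newsvendor_cost unlock.
exact: integrable_fin_num (integrable_loss q).
Qed.

(** Reduces cost differences to pointwise estimates of the loss, to which the two-valued bounds
    apply. *)
Lemma newsvendor_costB q q' :
  (newsvendor_cost b h F q - newsvendor_cost b h F q' =
   \int[law F]_x (loss q x - loss q' x)%:E)%E.
Proof.
rewrite /newsvendor_cost unlock.
under [RHS]eq_integral do rewrite EFinB.
have intB := integralB_EFin measurableT (integrable_loss q).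
by rewrite (intB _ (integrable_loss q')).
Qed.

Lemma newsvendor_costB_le q q' (A : set (measurableTypeR R)) p u v :
  measurable A -> law F A = p%:E ->
  (forall x, A x -> loss q x - loss q' x <= u) ->
  (forall x, ~ A x -> loss q x - loss q' x <= v) ->
  (newsvendor_cost b h F q - newsvendor_cost b h F q' <=
   (u * p + v * (1 - p))%:E)%E.
Proof.
move=> mA FA Au Av; rewrite newsvendor_costB.
exact: integral_le_two_valued FA Au Av.
Qed.

Lemma newsvendor_costB_ge q q' (A : set (measurableTypeR R)) p u v :
  measurable A -> law F A = p%:E ->
  (forall x, A x -> u <= loss q x - loss q' x) ->
  (forall x, ~ A x -> v <= loss q x - loss q' x) ->
  ((u * p + v * (1 - p))%:E <=
   newsvendor_cost b h F q - newsvendor_cost b h F q')%E.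
Proof.
move=> mA FA Au Av; rewrite newsvendor_costB.
exact: integral_ge_two_valued FA Au Av.
Qed.

Lemma lossE_le q x : x <= q -> loss q x = h * (q - x).
Proof.
move=> xq; rewrite /loss max_r ?subr_le0// max_l ?subr_ge0//.
by rewrite mulr0 add0r.
Qed.

Lemma lossE_ge q x : q <= x -> loss q x = b * (x - q).
Proof.
move=> xq; rewrite /loss max_l ?subr_ge0// max_r ?subr_le0//.
by rewrite mulr0 addr0.
Qed.

(** As a function of the order, the loss is piecewise linear, with slope [- b] below the demand and
    [h] above it. *)
Lemma lossB_bounds (q q' x : R) : q <= q' ->
  - (h * (q' - q)) <= loss q x - loss q' x <= b * (q' - q).
Proof.
move=> qq'.
have h0 y z : y <= z -> 0 <= h * (z - y)
  by move=> yz; rewrite mulr_ge0 ?subr_ge0// ltW.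
have b0 y z : y <= z -> 0 <= b * (z - y)
  by move=> yz; rewrite mulr_ge0 ?subr_ge0// ltW.
have hqq := h0 _ _ qq'; have bqq := b0 _ _ qq'.
have [xq|/ltW qx] := leP x q.
  by rewrite (lossE_le xq) (lossE_le (le_trans xq qq')); apply/andP; split; lra.
have hqx := h0 _ _ qx; have bqx := b0 _ _ qx.
have [xq'|/ltW q'x] := leP x q'.
  have hxq := h0 _ _ xq'; have bxq := b0 _ _ xq'.
  by rewrite (lossE_ge qx) (lossE_le xq'); apply/andP; split; lra.
by rewrite (lossE_ge qx) (lossE_ge q'x); apply/andP; split; lra.
Qed.

(** For [s < q], splitting at [D <= s] bounds the difference below by
    [(q - s) * ((b + h) * F s - b)]. For [q <= s], splitting at [D < s] gives
    [(s - q) * (b - (b + h) * cdf_left F s)]. The two sides of the quantile condition make these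
    nonnegative. *)
Lemma newsvendor_cost_qstar_min q :
  (0 <= newsvendor_cost b h F q - newsvendor_cost b h F (qstar b h F))%E.
Proof.
have [F0 Fm] := F_adm.
set s := qstar b h F.
have bh : 0 < b + h by exact: addr_gt0.
have [sq|qs] := ltP s q.
  have Fs : b <= F s * (b + h).
    by rewrite -ler_pdivrMr//; exact: cdf_qstar_ge.
  apply: le_trans (@newsvendor_costB_ge q s `]-oo, s]%classic (F s)
      (h * (q - s)) (- (b * (q - s))) _ _ _ _).
  - by rewrite lee_fin; nra.
  - exact: measurable_itv.
  - exact: law_itvNyc.
  - move=> x /=; rewrite in_itv/= => xs.
    by rewrite (lossE_le xs) (lossE_le (le_trans xs (ltW sq))); lra.
  - by move=> x _; have /andP[] := lossB_bounds x (ltW sq); lra.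
have Fs : cdf_left F s * (b + h) <= b.
  by rewrite -ler_pdivlMr//; exact: cdf_left_qstar_le.
apply: le_trans (@newsvendor_costB_ge q s `]-oo, s[%classic (cdf_left F s)
    (- (h * (s - q))) (b * (s - q)) _ _ _ _).
- by rewrite lee_fin; nra.
- exact: measurable_itv.
- exact: law_itvNyo.
- by move=> x _; have /andP[] := lossB_bounds x qs.
- move=> x /=; rewrite in_itv/= => /negP; rewrite -leNgt => sx.
  by rewrite (lossE_ge sx) (lossE_ge (le_trans qs sx)); lra.
Qed.

End cost.

(** * The least favourable distributions *)

Section atom_cdf.
Context (R : realType) (G : cdfType R) (lambda m : R).

(* For lambda <= m, the mass that G puts on [lambda, +oo[ is moved to the single
   point m; m = lambda and m = M are the least favourable choices. *)
Definition atom_cdf (x : R) : R :=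
  if x < lambda then G x else if x < m then cdf_left G lambda else 1.

Let atom_cdf_nondecreasing : nondecreasing atom_cdf.
Proof.
move=> x y xy; rewrite /atom_cdf.
have g1 : cdf_left G lambda <= 1.
  by rewrite (le_trans (cdf_left_le _ _))// cdfType_le1.
case: (ltP y lambda) => [yl|ly].
  by rewrite (le_lt_trans xy yl) (cumulative_is_nondecreasing G).
case: (ltP x lambda) => [xl|lx].
  by case: ifP => _; [exact: le_cdf_left|exact: cdfType_le1].
case: (ltP y m) => [ym|my]; first by rewrite (le_lt_trans xy ym).
by case: ifP.
Qed.

Let atom_cdf_right_continuous : right_continuous atom_cdf.
Proof.
move=> x; have [xl|lx] := ltP x lambda.
  have -> : atom_cdf x = G x by rewrite /atom_cdf xl.
  apply: cvg_trans (cumulative_is_right_continuous G x).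
  apply: near_eq_cvg; near=> y.
  have yl : y < lambda by near: y; exact: nbhs_right_lt.
  by rewrite /atom_cdf yl.
(* From [lambda] on, the function is constant just to the right of [x]: equal to 1 if [m <= x], to
   the left limit of [G] otherwise. *)
have [mx|xm] := leP m x; apply: cvg_near_cst; near=> y;
    have xy : x <= y by near: y; exact: nbhs_right_ge.
  by rewrite /atom_cdf !ltNge lx mx (le_trans lx xy) (le_trans mx xy).
have ym : y < m by near: y; exact: nbhs_right_lt.
by rewrite /atom_cdf xm ym !ltNge lx (le_trans lx xy).
Unshelve. all: by end_near. Qed.

Let atom_cdfNy : atom_cdf @ -oo --> (0 : R).
Proof.
apply: cvg_trans (cumulativeNy G); apply: near_eq_cvg; near=> y.
have yl : y < lambda by near: y; apply: nbhs_ninfty_lt; exact: num_real.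
by rewrite /atom_cdf yl.
Unshelve. all: by end_near. Qed.

Let atom_cdfy : atom_cdf @ +oo --> (1 : R).
Proof.
apply: cvg_near_cst; near=> y.
have ly : lambda <= y by near: y; apply: nbhs_pinfty_ge; exact: num_real.
have my : m <= y by near: y; apply: nbhs_pinfty_ge; exact: num_real.
by rewrite /atom_cdf !ltNge ly my.
Unshelve. all: by end_near. Qed.

HB.instance Definition _ := isCumulative.Build R _ R atom_cdf
  atom_cdf_nondecreasing atom_cdf_right_continuous.

HB.instance Definition _ := isCumulativeBounded.Build R 0 1 atom_cdf
  atom_cdfNy atom_cdfy.

Lemma atom_cdf_lt x : x < lambda -> atom_cdf x = G x.
Proof. by rewrite /atom_cdf => ->. Qed.

Lemma atom_cdf_ge x : lambda <= x -> m <= x -> atom_cdf x = 1.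
Proof. by move=> lx mx; rewrite /atom_cdf !ltNge lx mx. Qed.

Lemma atom_cdf_le x : x < m -> atom_cdf x <= cdf_left G lambda.
Proof.
by rewrite /atom_cdf => ->; case: ifPn => // xl; exact: le_cdf_left.
Qed.

Lemma cdf_left_atom_cdf : lambda <= m ->
  cdf_left (atom_cdf : cdfType R) m = cdf_left G lambda.
Proof.
move=> lm; apply/le_anti/andP; split.
  by apply: cdf_left_lub => x; exact: atom_cdf_le.
apply: cdf_left_lub => x xl; rewrite -atom_cdf_lt//.
by apply: (@le_cdf_left _ (atom_cdf : cdfType R)); exact: lt_le_trans lm.
Qed.

End atom_cdf.

(** * Upper and lower bounds on the worst-case regret *)

Section minimax.
Context (R : realType) (b h M lambda : R) (G : cdfType R).
Hypotheses (b_gt0 : 0 < b) (h_gt0 : 0 < h).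

(** Reduces minimaxity to a saddle-type check: a value reached at one order and beaten by none. *)
Lemma minimax_optimalP q r : 0 <= q <= M ->
  regret b h M lambda G q = r ->
  (forall q', 0 <= q' <= M -> (r <= regret b h M lambda G q')%E) ->
  minimax_optimal b h M lambda G q /\ minimax_risk b h M lambda G = r.
Proof.
move=> q0M qr r_le.
have rE : minimax_risk b h M lambda G = r.
  apply/le_anti/andP; split.
    by apply: ereal_inf_lbound; exists q => //=; rewrite in_itv.
  apply: le_ereal_inf_tmp => _ [q' /= q'M <-]; apply: r_le.
  by move: q'M; rewrite in_itv.
by rewrite /minimax_optimal q0M qr rE.
Qed.

Lemma regret_ge F q :
  ambiguity_set b h M lambda G F ->
  (newsvendor_cost b h F q - newsvendor_cost b h F (qstar b h F) <=
   regret b h M lambda G q)%E.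
Proof. by move=> GF; apply: ereal_sup_ubound; exists F. Qed.

Hypotheses (lambda_ge0 : 0 <= lambda) (G_adm : admissible b h M G).

Let G0 : nonneg_support G. Proof. by case: G_adm. Qed.

Lemma ambiguity_set_self : ambiguity_set b h M lambda G G.
Proof. by []. Qed.

Lemma nonneg_support_atom_cdf m :
  nonneg_support (atom_cdf G lambda m : cdfType R).
Proof.
apply: nonneg_supportP => x x0 /=.
by rewrite atom_cdf_lt ?(lt_le_trans x0)//; exact: nonneg_support_lt0.
Qed.

(** Before [m] the function never exceeds the left limit of [G], which is below the critical ratio;
    at [m] it jumps to 1. *)
Lemma qstar_atom_cdf m :
  lambda <= m -> cdf_left G lambda < critical_ratio b h ->
  qstar b h (atom_cdf G lambda m : cdfType R) = m.
Proof.
move=> lm gr; apply: qstar_eq => //.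
- exact: nonneg_support_atom_cdf.
- by rewrite /= atom_cdf_ge// ltW// critical_ratio_lt1.
- by move=> x xm; apply: le_lt_trans gr; exact: atom_cdf_le.
Qed.

Lemma ambiguity_set_atom_cdf m :
  lambda <= m <= M -> cdf_left G lambda < critical_ratio b h ->
  ambiguity_set b h M lambda G (atom_cdf G lambda m : cdfType R).
Proof.
move=> /andP[lm mM] gr; split; last by move=> x; exact: atom_cdf_lt.
have N0 := nonneg_support_atom_cdf m.
split => //; last by rewrite qstar_atom_cdf.
by apply: (@finite_mean_bounded _ _ m) => //=; exact: atom_cdf_ge.
Qed.

Lemma qstar_ambiguity_set F :
  critical_ratio b h <= cdf_left G lambda ->
  ambiguity_set b h M lambda G F -> qstar b h F = qstar b h G.
Proof.
move=> rg [[F0 _ _] FG]; apply: qstar_eq => //.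
  (* If the quantile of [G] is not below [lambda], then [F] at that point is at least its left limit
     at [lambda], which is the one of [G]. *)
  have [sl|ls] := ltP (qstar b h G) lambda.
    by rewrite FG//; exact: cdf_qstar_ge.
  rewrite (le_trans rg)// -(eq_cdf_left FG).
  by rewrite (le_trans (cdf_left_le _ _))// (cumulative_is_nondecreasing F).
move=> x xs; have [xl|lx] := ltP x lambda.
  by rewrite FG//; exact: cdf_lt_qstar xs.
(* A point with [lambda <= x] before the quantile is impossible, since [G] has already reached the
   critical ratio at [lambda]. *)
suff : critical_ratio b h <= G x.
  by rewrite leNgt => /negP; case; exact: cdf_lt_qstar xs.
rewrite (le_trans rg)// (le_trans (cdf_left_le _ _))//.
exact: (cumulative_is_nondecreasing G).
Qed.

Lemma lambda_le_qstar F :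
  cdf_left G lambda < critical_ratio b h ->
  ambiguity_set b h M lambda G F -> lambda <= qstar b h F.
Proof.
move=> gr [_ FG]; apply: qstar_ge => // x xl; apply: le_lt_trans gr.
by rewrite FG//; exact: le_cdf_left.
Qed.

Lemma newsvendor_cost_gap_le F q :
  cdf_left G lambda < critical_ratio b h ->
  ambiguity_set b h M lambda G F -> lambda <= q <= M ->
  (newsvendor_cost b h F q - newsvendor_cost b h F (qstar b h F) <=
   (Num.max (h * (q - lambda))
     ((M - q) * (b - (b + h) * cdf_left G lambda)))%:E)%E.
Proof.
move=> gr GF /andP[lq qM].
have ls := lambda_le_qstar gr GF.
have [[F0 Fm sM] FG] := GF.
have F_adm : nonneg_support F /\ finite_mean F by [].
set s := qstar b h F in ls sM *.
have gr' : cdf_left G lambda * (b + h) < b by rewrite -ltr_pdivlMr// addr_gt0.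
have [qs|sq] := leP q s; last first.
  have hb x : loss b h q x - loss b h s x <= h * (q - s).
    by have /andP[+ _] := lossB_bounds b_gt0 h_gt0 x (ltW sq); lra.
  (* The bound [h * (q - s)] is uniform, so the event is the whole space; the value 0 off it has
     weight zero. Then [lambda <= s] concludes. *)
  apply: le_trans (@newsvendor_costB_le _ _ _ b_gt0 h_gt0 _ F_adm q s setT 1
    (h * (q - s)) 0 _ _ _ _) _.
  - exact: measurableT.
  - exact: probability_setT.
  - by move=> x _; exact: hb.
  - by move=> x /(_ I).
  by rewrite lee_fin le_max subrr mulr0 addr0 mulr1 ler_pM2l ?lerB.
apply: le_trans (@newsvendor_costB_le _ _ _ b_gt0 h_gt0 _ F_adm q s
  `]-oo, lambda[%classic (cdf_left G lambda) (- (h * (s - q))) (b * (s - q))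
  _ _ _ _) _.
- exact: measurable_itv.
- by rewrite -(eq_cdf_left FG); exact: law_itvNyo.
- move=> x /=; rewrite in_itv/= => /ltW xl.
  rewrite (lossE_le b h (le_trans xl lq)) (lossE_le b h (le_trans xl ls)).
  by lra.
- by move=> x _; have /andP[] := lossB_bounds b_gt0 h_gt0 x qs.
rewrite lee_fin le_max; apply/orP; right.
(* The bound [(s - q) * (b - (b + h) * g)], with [g] the left limit of [G], increases with [s]; this
   product is its slack with respect to [s = M]. *)
have : 0 <= (M - s) * (b - cdf_left G lambda * (b + h)).
  by rewrite mulr_ge0// subr_ge0// ltW.
by lra.
Qed.

Lemma regret_le q :
  cdf_left G lambda < critical_ratio b h -> lambda <= q <= M ->
  (regret b h M lambda G q <=
   (Num.max (h * (q - lambda))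
     ((M - q) * (b - (b + h) * cdf_left G lambda)))%:E)%E.
Proof.
move=> gr lqM; apply: ge_ereal_sup => _ [F GF <-].
exact: newsvendor_cost_gap_le.
Qed.

Lemma regret_ge_lambda q :
  cdf_left G lambda < critical_ratio b h -> lambda <= M -> lambda <= q ->
  ((h * (q - lambda))%:E <= regret b h M lambda G q)%E.
Proof.
move=> gr lM lq; pose F : cdfType R := atom_cdf G lambda lambda.
have GF : ambiguity_set b h M lambda G F.
  by apply: ambiguity_set_atom_cdf => //; rewrite lexx.
have F_adm : nonneg_support F /\ finite_mean F by case: GF => -[].
apply: le_trans (regret_ge q GF); rewrite qstar_atom_cdf//.
(* All the mass lies on []-oo, lambda]], so the crude bound [- (b * (q - lambda))] off it has weight
   zero. *)
apply: le_trans (@newsvendor_costB_ge _ _ _ b_gt0 h_gt0 _ F_adm q lambda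
  `]-oo, lambda]%classic 1 (h * (q - lambda)) (- (b * (q - lambda))) _ _ _ _).
- by rewrite lee_fin; lra.
- exact: measurable_itv.
- by rewrite law_itvNyc /= atom_cdf_ge.
- move=> x /=; rewrite in_itv/= => xl.
  by rewrite (lossE_le b h xl) (lossE_le b h (le_trans xl lq)); lra.
- by move=> x _; have /andP[] := lossB_bounds b_gt0 h_gt0 x lq; lra.
Qed.

(** The law with its atom at [M] has no mass in [[lambda, M[], so [D < M] has the probability of
    [D < lambda]. As [q] may lie below [lambda], the loss difference on that event is only bounded
    below. *)
Lemma regret_ge_M q :
  cdf_left G lambda < critical_ratio b h -> lambda <= M -> q <= M ->
  (((M - q) * (b - (b + h) * cdf_left G lambda))%:E <=
   regret b h M lambda G q)%E.
Proof.
move=> gr lM qM; pose F : cdfType R := atom_cdf G lambda M.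
have GF : ambiguity_set b h M lambda G F.
  by apply: ambiguity_set_atom_cdf => //; rewrite lexx andbT.
have F_adm : nonneg_support F /\ finite_mean F by case: GF => -[].
apply: le_trans (regret_ge q GF); rewrite qstar_atom_cdf//.
apply: le_trans (@newsvendor_costB_ge _ _ _ b_gt0 h_gt0 _ F_adm q M
  `]-oo, M[%classic (cdf_left G lambda) (- (h * (M - q))) (b * (M - q))
  _ _ _ _).
- by rewrite lee_fin; lra.
- exact: measurable_itv.
- by rewrite law_itvNyo cdf_left_atom_cdf.
- by move=> x _; have /andP[] := lossB_bounds b_gt0 h_gt0 x qM.
- move=> x /=; rewrite in_itv/= => /negP; rewrite -leNgt => Mx.
  by rewrite (lossE_ge b h Mx) (lossE_ge b h (le_trans qM Mx)); lra.
Qed.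

End minimax.

(* In the first case the strict inequality qstar < lambda fails exactly when
   G^-(lambda) = rho is approached but not reached below lambda; then
   qstar = lambda (for instance G uniform on [0, 1] and lambda = rho). *)
Theorem theorem1 (R : realType) (b h M lambda : R) (G : cdfType R)
  (b_gt0 : 0 < b) (h_gt0 : 0 < h) (M_ge0 : 0 <= M) (lambda_ge0 : 0 <= lambda)
  (G_adm : admissible b h M G) :
  (critical_ratio b h <= cdf_left G lambda ->
     [/\ minimax_optimal b h M lambda G (qstar b h G),
         qstar b h G < lambda \/
           [/\ qstar b h G = lambda,
               cdf_left G lambda = critical_ratio b h &
               forall x : R, x < lambda -> G x < critical_ratio b h] &
         minimax_risk b h M lambda G = 0%E]) /\
  (cdf_left G lambda < critical_ratio b h ->
     [/\ minimax_optimal b h M lambda G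
           ((b * M + h * lambda - (b + h) * cdf_left G lambda * M) /
            ((b + h) * (1 - cdf_left G lambda))),
         minimax_risk b h M lambda G =
           (h * (b - (b + h) * cdf_left G lambda) * (M - lambda) /
            ((b + h) * (1 - cdf_left G lambda)))%:E &
         0 <= h * (b - (b + h) * cdf_left G lambda) * (M - lambda) /
              ((b + h) * (1 - cdf_left G lambda))]).
Proof.
have [G0 Gm sM] := G_adm.
have GG := ambiguity_set_self lambda G_adm.
split=> [rg|gr].
  have regret0 : regret b h M lambda G (qstar b h G) = 0%E.
    apply/le_anti/andP; split.
      apply: ge_ereal_sup => _ [F GF <-].
      (* All laws in the set share the quantile of [G]; subtracting a cost from itself in the
         extended reals gives 0 because it is finite. *)
      rewrite (qstar_ambiguity_set b_gt0 h_gt0 G_adm rg GF) subee//.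
      by case: GF => -[F0 Fm _] _; exact: newsvendor_cost_fin_num.
    by apply: le_trans (regret_ge _ GG); exact: newsvendor_cost_qstar_min.
  have [|//|opt ->] := @minimax_optimalP _ b h M lambda G _ _ _ regret0.
  - by rewrite sM andbT; exact: qstar_ge0.
  - move=> q _; apply: le_trans (regret_ge _ GG).
    exact: newsvendor_cost_qstar_min.
  split=> //.
  (* In the boundary case [G] stays under the critical ratio before [lambda], which caps its left
     limit there; the hypothesis gives the reverse inequality. *)
  have [|ls] := ltP (qstar b h G) lambda; [by left|right].
  have Glt x : x < lambda -> G x < critical_ratio b h.
    by move=> xl; apply: cdf_lt_qstar => //; exact: lt_le_trans ls.
  split => //.
    apply: qstar_eq => //; exact: le_trans rg (cdf_left_le _ _).
  by apply/le_anti; rewrite rg andbT; apply: cdf_left_lub => x /Glt/ltW.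
have lM : lambda <= M.
  exact: le_trans (lambda_le_qstar b_gt0 h_gt0 gr GG) sM.
set g := cdf_left G lambda in gr *.
have bh : 0 < b + h by exact: addr_gt0.
have g1 : 0 < 1 - g by rewrite subr_gt0 (lt_trans gr)// critical_ratio_lt1.
have bg : 0 < b - (b + h) * g by rewrite subr_gt0 mulrC -ltr_pdivlMr.
have D0 : 0 < (b + h) * (1 - g) by exact: mulr_gt0.
set q := (X in minimax_optimal _ _ _ _ _ X).
set Delta := (X in _ = X%:E).
(* [q] solves [h * (q - lambda) = (M - q) * (b - (b + h) * g)], and [Delta] is the common value. Its
   sign then places [q] between [lambda] and [M]. *)
have ql : h * (q - lambda) = Delta by rewrite /q /Delta; field; rewrite !gt_eqF.
have qM : (M - q) * (b - (b + h) * g) = Delta.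
  by rewrite /q /Delta; field; rewrite !gt_eqF.
have Delta0 : 0 <= Delta.
  by rewrite divr_ge0 ?mulr_ge0 ?subr_ge0// ltW// -subr_gt0.
have lq : lambda <= q by rewrite -subr_ge0 -(pmulr_rge0 _ h_gt0) ql.
have qM0 : q <= M by rewrite -subr_ge0 -(pmulr_lge0 _ bg) qM.
have [|||opt ->//] := @minimax_optimalP _ b h M lambda G q Delta%:E.
- by rewrite qM0 (le_trans lambda_ge0).
- apply/le_anti/andP; split.
    apply: le_trans (regret_le b_gt0 h_gt0 gr _) _ => //.
      by rewrite lq.
    by rewrite lee_fin -/g ql qM maxxx.
  by rewrite -ql; exact: regret_ge_lambda.
(* Orders up to [q], including those below [lambda], are penalized by the atom at [M]; larger ones
   by the atom at [lambda]. *)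
- move=> q' /andP[q'0 q'M]; have [q'q|qq'] := leP q' q.
    apply: le_trans (regret_ge_M b_gt0 h_gt0 lambda_ge0 G_adm gr lM q'M).
    by rewrite lee_fin -qM ler_pM2r// lerB.
  apply: le_trans (regret_ge_lambda b_gt0 h_gt0 lambda_ge0 G_adm gr lM _).
    by rewrite lee_fin -ql ler_pM2l// lerB// ltW.
  exact: le_trans lq (ltW qq').
Qed.
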